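(* Let $\mathbf X,\mathbf Y$ be finite dimensional Hilbert spaces, $\varphi:\mathbf X\to\mathbb R$ and $\Phi:\mathbf X\to\mathbf Y$ twice continuously differentiable, $g:\mathbf Y\to\overline{\mathbb R}$ proper, lower semicontinuous and convex, and let $\Theta\subset\mathbf X$ be a polyhedral convex set. Let $(\bar x,\bar y)$ be a solution to the KKT system $0\in\nabla_xL(x,y)+N_\Theta(x)$, $y\in\partial g(\Phi(x))$. Assume that the second subderivative of $g$ at $\Phi(\bar x)$ for $\bar y$ is semi-stable and that there is a positive constant $\ell$ such that $$\langle\nabla^2_{xx}L(\bar x,\bar y)w,w\rangle+\mathrm d^2g(\Phi(\bar x),\bar y)(\nabla\Phi(\bar x)w)\ge\ell\|w\|^2\quad\text{for all }w\in\mathcal D,$$ where $\mathcal D:=K_\Theta(\bar x,-\nabla_xL(\bar x,\bar y))\cap\{w\in\mathbf X\mid\nabla\Phi(\bar x)w\in K_g(\Phi(\bar x),\bar y)\}$. Then there exist positive constants $\bar\rho$ and $\gamma$ for which the uniform quadratic growth condition $$\mathcal L(x,y,\rho)\ge\mathcal L(\bar x,y,\rho)+\frac\kappa2\|x-\bar x\|^2\quad\text{for all }x\in\Theta\cap\mathbb B_\gamma(\bar x),\ y\in M_{\bar x,\psi}(0,0)\cap\mathbb B_\gamma(\bar y),\ \rho\ge\bar\rho,$$ is fulfilled for all $\kappa\in[0,\ell)$.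
   Context: $\overline{\mathbb R}=[-\infty,\infty]$; $\mathbb B_r(x)$ is the closed ball of radius $r$ centered at $x$; $N_\Theta$, $T_\Theta$ are the normal and tangent cones, $\delta_\Theta$ is the indicator function, $\partial$ is the subdifferential of convex analysis, and $[v]=\{tv\mid t\in\mathbb R\}$. Lagrangian: $L(x,y)=\varphi(x)+\langle y,\Phi(x)\rangle$. Augmented Lagrangian of the problem of minimizing $\psi(x)=\varphi(x)+g(\Phi(x))$ over $x\in\Theta$: for $\rho>0$, $\mathcal L(x,y,\rho)=\varphi(x)+(e_{1/\rho}g)(\Phi(x)+\rho^{-1}y)-\tfrac12\rho^{-1}\|y\|^2$, where $(e_{1/\rho}g)(y)=\inf_{z\in\mathbf Y}\{g(z)+\tfrac12\rho\|y-z\|^2\}$. Set of Lagrange multipliers associated with $\bar x$: $M_{\bar x,\psi}(0,0)=\{y\in\mathbf Y\mid0\in\nabla_xL(\bar x,y)+N_\Theta(\bar x),\ y\in\partial g(\Phi(\bar x))\}$. Subderivative: $\mathrm df(\bar x)(w)=\liminf_{t\searrow0,\,w'\to w}\frac{f(\bar x+tw')-f(\bar x)}t$. Critical cone, for $\bar v\in\partial f(\bar x)$: $K_f(\bar x,\bar v)=\{w\mid\langle\bar v,w\rangle=\mathrm df(\bar x)(w)\}$; for a set, $K_\Theta(\bar x,\bar v)=K_{\delta_\Theta}(\bar x,\bar v)=T_\Theta(\bar x)\cap[\bar v]^\perp$. Second-order difference quotient: $\Delta_t^2f(\bar x,\bar v)(w)=\frac{f(\bar x+tw)-f(\bar x)-t\langle\bar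 v,w\rangle}{\frac12t^2}$. Second subderivative: $\mathrm d^2f(\bar x,\bar v)(w)=\liminf_{t\searrow0,\,w'\to w}\Delta_t^2f(\bar x,\bar v)(w')$. Semi-strict second subderivative: $\widehat{\mathrm d}^2f(\bar x,\bar v)(w)=\liminf_{t\searrow0,\,w'\to w,\,v\to\bar v,\,v\in\partial f(\bar x)}\Delta_t^2f(\bar x,v)(w')$. The second subderivative of $f$ at $\bar x$ for $\bar v$ is semi-stable if $\widehat{\mathrm d}^2f(\bar x,\bar v)(w)=\mathrm d^2f(\bar x,\bar v)(w)$ for all $w\in K_f(\bar x,\bar v)$.
   Formalization: The constants ρ̄ and γ are chosen after κ and may depend on it; a single pair valid for all κ∈[0,ℓ) at once need not exist (e.g. φ(x)=ℓx²/2−x⁴, Φ=0, g=0, Θ=ℝ). *)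

(* Defs.v *)
From HB Require Import structures.
From mathcomp Require Import all_boot all_order all_algebra.
From mathcomp Require Import sesquilinear.
From mathcomp Require Import all_classical all_reals all_analysis.

Set Implicit Arguments.
Unset Strict Implicit.
Unset Printing Implicit Defensive.

Import Order.TTheory GRing.Theory Num.Theory.
Import numFieldNormedType.Exports.

Local Open Scope classical_set_scope.
Local Open Scope ring_scope.

(* Finite dimensionality comes from [Vector]; over a [realType] completeness is
   then automatic. *)
HB.mixin Record NormedModule_hasInner (R : realType) (X : Type)
    of NormedModule R X := {
  inner : {dot X for @idfun R};
  inner_norm : forall x : X, inner x x = `|x| ^+ 2
}.

#[short(type="finHilbertType")]
HB.structure Definition FinHilbert (R : realType) :=
  { X of NormedModule_hasInner R X & Vector R X & NormedModule R X }.

Notation "''[' u , v ]" := (inner u v) (format "''[' u ,  v ]") : ring_scope.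

Section smoothness.
Context {R : realType} {V W : normedModType R}.
Implicit Type f : V -> W.

(* For finite dimensional V, continuity (resp. differentiability) of
   x |-> 'd f x in operator norm is the same as that of x |-> 'd f x h for
   every h. *)
Definition continuously_differentiable f :=
  (forall x, differentiable f x) /\ forall h, continuous (fun x => 'd f x h).

Definition twice_continuously_differentiable f :=
  (forall x, differentiable f x) /\
  forall h, continuously_differentiable (fun x => 'd f x h).

End smoothness.

Section variational.
Context {R : realType} {X : finHilbertType R}.
Implicit Types (f : X -> \bar R) (Theta : set X) (x v w : X).

(* The Riesz representative of the differential. *)
Definition gradient (f : X -> R) x : X :=
  xget 0 [set v | forall h, '[v, h] = 'd f x h].

Definition hessian (f : X -> R) x : X -> X := 'd (gradient f) x.

Definition proper_fun f :=
  (forall x, (-oo < f x)%E) /\ exists x, (f x < +oo)%E.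

Definition convex_efun f := forall x y (t : R), 0 < t < 1 ->
  (f (t *: x + (1 - t) *: y)%R <= t%:E * f x + (1 - t)%:E * f y)%E.

Definition polyhedral Theta := exists (m : nat) (a : 'I_m -> X) (b : 'I_m -> R),
  Theta = [set x | forall i, '[a i, x] <= b i].

Definition indicator Theta x : \bar R := if x \in Theta then 0%E else +oo%E.

Definition normal_cone Theta x : set X :=
  [set v | Theta x /\ forall z, Theta z -> '[v, z - x] <= 0].

Definition subdifferential f x : set X :=
  [set v | f x \is a fin_num /\
           forall z, (f x + '[v, z - x]%:E <= f z)%E].

Definition subderivative f x w : \bar R :=
  limf_einf (fun p : R * X => ((f (x + p.1 *: p.2)%R - f x) * (p.1^-1)%:E)%E)
    (filter_prod 0^'+ (nbhs w)).

Definition critical_cone f x v : set X :=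
  [set w | '[v, w]%:E = subderivative f x w].

Definition diff_quotient2 f x v (t : R) w : \bar R :=
  ((f (x + t *: w)%R - f x - (t * '[v, w])%:E) * ((2^-1 * t ^+ 2)^-1)%:E)%E.

Definition second_subderivative f x v w : \bar R :=
  limf_einf (fun p : R * X => diff_quotient2 f x v p.1 p.2)
    (filter_prod 0^'+ (nbhs w)).

Definition semistrict_second_subderivative f x v w : \bar R :=
  limf_einf (fun p : R * X * X => diff_quotient2 f x p.2 p.1.1 p.1.2)
    (filter_prod (filter_prod 0^'+ (nbhs w))
                 (within (subdifferential f x) (nbhs v))).

Definition semi_stable f x v := forall w, critical_cone f x v w ->
  semistrict_second_subderivative f x v w = second_subderivative f x v w.

Definition moreau_envelope (r : R) f x : \bar R :=
  ereal_inf [set (f z + (2^-1 * r^-1 * `|x - z| ^+ 2)%:E)%E | z in [set: X]].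

End variational.

Section composite_problem.
Context {R : realType} {X Y : finHilbertType R}.
Variables (phi : X -> R) (Phi : X -> Y) (g : Y -> \bar R) (Theta : set X).
Implicit Types (x w : X) (y : Y).

Definition lagrangian x y : R := phi x + '[y, Phi x].

Definition augmented_lagrangian x y (rho : R) : \bar R :=
  ((phi x)%:E + moreau_envelope rho^-1 g (Phi x + rho^-1 *: y)%R
   - (2^-1 * rho^-1 * `|y| ^+ 2)%:E)%E.

Definition kkt_solution x y :=
  [set gradient (lagrangian ^~ y) x + v | v in normal_cone Theta x] 0 /\
  subdifferential g (Phi x) y.

Definition multipliers x : set Y := [set y | kkt_solution x y].

Definition critical_directions x y : set X :=
  critical_cone (indicator Theta) x (- gradient (lagrangian ^~ y) x)
  `&` [set w | critical_cone g (Phi x) y ('d Phi x w)].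

End composite_problem.

(* Main.v *)
Require Import Defs.
From HB Require Import structures.
From mathcomp Require Import all_boot all_order all_algebra.
From mathcomp Require Import sesquilinear.
From mathcomp Require Import all_classical all_reals all_analysis.
From mathcomp Require Import ring lra.

Set Implicit Arguments.
Unset Strict Implicit.
Unset Printing Implicit Defensive.

Import Order.TTheory GRing.Theory Num.Theory.
Import numFieldNormedType.Exports.

Local Open Scope classical_set_scope.
Local Open Scope ring_scope.

(** Argue by contradiction, along sequences [x k --> xbar], [y k --> ybar] and
    [rho k --> +oo] violating the growth condition. The infimum defining the
    Moreau envelope yields points [z k] with
    [phi x - phi xbar + '[y, Phi x - Phi xbar] + D + rho / 2 * `|Phi x - z| ^+ 2
     < kappa / 2 * t ^+ 2], where [t = `|x - xbar|] and
    [D = g z - g (Phi xbar) - '[y, z - Phi xbar] >= 0].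
    Expanding the Lagrangian to second order at [xbar], all these terms are
    [O(t ^+ 2)]; hence [`|Phi x - z| = o(t)], and if [(x - xbar) / t --> w] (along an
    ultrafilter) then [(z - Phi xbar) / t --> 'd Phi xbar w]. Dividing by [t] shows
    that [w] is a critical direction; dividing by [t ^+ 2 / 2] bounds the
    semi-strict second subderivative of [g] at ['d Phi xbar w] by [kappa] minus
    the Hessian term, which semi-stability turns into [ell <= kappa]. *)

(** * Inner product: Cauchy-Schwarz, frames, Riesz representation, compact sphere *)

Section inner_product.
Context {R : realType} {X : finHilbertType R}.
Implicit Types (u v w : X) (a : R).

Lemma innerC u v : '[u, v] = '[v, u].
Proof. by rewrite hermC /= expr0 mul1r. Qed.

Lemma innerDl w : {morph inner^~ w : u v / u + v}.
Proof. by move=> u v; rewrite linearDl. Qed.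

Lemma innerDr w : {morph inner w : u v / u + v}.
Proof. by move=> u v; rewrite linearDr. Qed.

Lemma innerBl w : {morph inner^~ w : u v / u - v}.
Proof. by move=> u v; rewrite linearBl. Qed.

Lemma innerBr w : {morph inner w : u v / u - v}.
Proof. by move=> u v; rewrite linearBr. Qed.

Lemma innerNl u v : '[- u, v] = - '[u, v].
Proof. by rewrite linearNl. Qed.

Lemma innerZl a u v : '[a *: u, v] = a * '[u, v].
Proof. by rewrite linearZl_LR. Qed.

Lemma innerZr a u v : '[u, a *: v] = a * '[u, v].
Proof. by rewrite linearZr_LR. Qed.

Lemma inner0l u : '[0, u] = 0.
Proof. by rewrite linear0l. Qed.

Lemma inner0r u : '[u, 0] = 0.
Proof. by rewrite linear0r. Qed.

Lemma inner_suml I (r : seq I) (P : pred I) (F : I -> X) u :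
  '[\sum_(i <- r | P i) F i, u] = \sum_(i <- r | P i) '[F i, u].
Proof. exact: (big_morph _ (innerDl u) (inner0l u)). Qed.

Lemma inner_sumr I (r : seq I) (P : pred I) (F : I -> X) u :
  '[u, \sum_(i <- r | P i) F i] = \sum_(i <- r | P i) '[u, F i].
Proof. exact: (big_morph _ (innerDr u) (inner0r u)). Qed.

Lemma inner_eq0 u : '[u, u] = 0 -> u = 0.
Proof.
by rewrite inner_norm => /eqP; rewrite sqrf_eq0 normr_eq0 => /eqP.
Qed.

Lemma normr_innerD u v : `|u + v| ^+ 2 = `|u| ^+ 2 + 2 * '[u, v] + `|v| ^+ 2.
Proof.
rewrite -!inner_norm innerDl !innerDr (innerC v u); ring.
Qed.

Lemma normr_inner_le u v : `|'[u, v]| <= `|u| * `|v|.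
Proof.
have [->|v0] := eqVneq v 0; first by rewrite inner0r !normr0 mulr0.
rewrite -(@ler_pXn2r _ 2) ?nnegrE ?mulr_ge0// real_normK ?num_real// exprMn.
have V : 0 < `|v| ^+ 2 by rewrite exprn_gt0// normr_gt0.
rewrite -subr_ge0 -(pmulr_rge0 _ V).
(* The square expands to |v|^2 (|u|^2 |v|^2 - <u, v>^2), which is the goal after multiplication by
   |v|^2. *)
have := sqr_ge0 `| `|v| ^+ 2 *: u - '[u, v] *: v|.
rewrite -scaleNr normr_innerD innerZl innerZr !normrZ !exprMn normrN.
rewrite !real_normK ?num_real ?realE ?sqr_ge0//.
by congr (0 <= _); ring.
Qed.

Lemma inner_continuous u : continuous (inner u : X -> R^o).
Proof.
apply/(@linear_bounded_continuous _ _ _ (inner u : {linear X -> R^o})).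
exists `|u|; split; first exact: num_real.
move=> M uM; near=> v => /=.
rewrite (le_trans (normr_inner_le _ _))// -[leRHS]mulr1 ler_pM// ?(ltW uM)//.
Unshelve. all: by end_near. Qed.

(* The frame operator [v |-> \sum_i '[v, b i] *: b i] of a basis [b] is positive
   definite; [d i] is the preimage of [b i]. *)
Lemma dual_frame : exists (n : nat) (b d : 'I_n -> X),
  forall v, v = \sum_i '[v, b i] *: d i.
Proof.
pose b (i : 'I_(\dim {:X})) : X := (vbasis {:X})`_i.
pose F v := \sum_i '[v, b i] *: b i.
have Flin : linear F.
  move=> a u v; rewrite /F scaler_sumr -big_split; apply: eq_bigr => i _ /=.
  by rewrite innerDl innerZl scalerDl scalerA.
pose Fl := GRing.isLinear.Build _ _ _ _ F Flin.
pose FL : {linear X -> X} := HB.pack F Fl.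
pose f := linfun FL.
have kf : lker f == 0%VS.
  apply/eqP/vspaceP => v; rewrite memv_ker memv0; apply/eqP/eqP => [|->]; last first.
    by rewrite linear0.
  rewrite lfunE /= /F.
  (* Pairing [F v = 0] with [v] gives a vanishing sum of squares, so [v] is orthogonal to a basis,
     hence to itself. *)
  move/(congr1 (inner v)); rewrite inner_sumr [RHS]inner0r.
  under eq_bigr do rewrite innerZr -expr2.
  move/eqP; rewrite psumr_eq0 => [/allP vb0|i _]; last exact: sqr_ge0.
  have vbi i : '[v, b i] = 0.
    by apply/eqP; rewrite -sqrf_eq0; apply: vb0; rewrite mem_index_enum.
  apply: inner_eq0; rewrite {2}(coord_vbasis (memvf v)) inner_sumr.
  by rewrite big1// => i _; rewrite innerZr vbi mulr0.
exists (\dim {:X}), b, (fun i => (f^-1)%VF (b i)) => v.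
rewrite -{1}[v](lker0_lfunK kf) lfunE /= /F linear_sum.
by apply: eq_bigr => i _; rewrite linearZ.
Qed.

(** Applying [l] to the frame expansion of [h] exhibits the representative
    [\sum_i l (d i) *: b i]. *)
Lemma riesz (l : {linear X -> R^o}) : exists v, forall h, '[v, h] = l h.
Proof.
have [n [b [d bd]]] := dual_frame.
exists (\sum_i l (d i) *: b i) => h.
rewrite {2}(bd h) linear_sum inner_suml; apply: eq_bigr => i _.
by rewrite innerZl linearZ /= innerC mulrC.
Qed.

(** The sphere is closed and lies in the image, under the continuous synthesis map [s], of a compact
    box of frame coefficients; Cauchy-Schwarz gives the sides of the box. *)
Lemma sphere_compact : compact [set w : X | `|w| = 1].
Proof.
have [n [b [d bd]]] := dual_frame.
pose K : set 'rV[R]_n := [set c | forall i, c ord0 i \in `[- `|b i|, `|b i|]].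
have cK : compact K.
  by apply: (@rV_compact _ _ (fun i => [set` `[- `|b i|, `|b i|]])) => i;
    exact: segment_compact.
pose s (c : 'rV[R]_n) : X := \sum_i c ord0 i *: d i.
have cs : continuous s.
  apply: continuous_big => [|i _]; first exact: add_continuous.
  by move=> c; apply: (@cvgZr_tmp _ _ _ (nbhs c)); exact: coord_continuous.
apply: (subclosed_compact _ (continuous_compact (continuous_subspaceT cs) cK)).
  rewrite (_ : mkset _ = (@Num.norm _ X) @^-1` [set 1])//.
  by apply: closed_comp => [w _|]; [exact: norm_continuous|exact: closed_eq].
move=> w /= w1; exists (\row_i '[w, b i]).
  move=> i; rewrite mxE in_itv /= -ler_norml.
  by rewrite (le_trans (normr_inner_le _ _))// w1 mul1r.
by rewrite /s [RHS]bd; apply: eq_bigr => i _; rewrite mxE.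
Qed.

End inner_product.

(** * Gradients and the second-order Taylor expansion *)

Section gradient.
Context {R : realType} {X : finHilbertType R}.
Implicit Types (f : X -> R) (x u h : X).

(** Riesz representation ensures that the default value of [xget] is never taken. *)
Lemma gradientE f x h : '[gradient f x, h] = 'd f x h.
Proof.
have [v vP] := riesz ('d f x).
rewrite /gradient; case: xgetP => [w _ ->//|/(_ v)].
by move=> /(_ vP).
Qed.

Lemma gradient_unique f x v : (forall h, '[v, h] = 'd f x h) -> gradient f x = v.
Proof.
move=> vP; apply/eqP; rewrite -subr_eq0; apply/eqP/inner_eq0.
by rewrite innerBl gradientE vP subrr.
Qed.

(** A dual frame writes the gradient as a finite sum of fixed vectors [b i] weighted by the
    differentiable functions ['d f z (d i)]. *)
Lemma differentiable_gradient f x :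
  twice_continuously_differentiable f -> differentiable (gradient f) x.
Proof.
move=> [_ f2]; have [n [b [d bd]]] := @dual_frame R X.
have -> : gradient f = \sum_(i < n) (fun z => 'd f z (d i) *: b i).
  apply/funext => z; apply: gradient_unique => h.
  rewrite fct_sumE inner_suml {2}(bd h) linear_sum; apply: eq_bigr => i _.
  by rewrite innerZl linearZ /= innerC mulrC.
apply: differentiable_sum => i.
by apply: differentiableZl; have [] := f2 (d i).
Qed.

Lemma is_derive_line {W : normedModType R} (F : X -> W) x u (s : R) :
  differentiable F (x + s *: u) ->
  is_derive s 1 (fun t : R => F (x + t *: u)) ('d F (x + s *: u) u).
Proof.
move=> dF; set G := fun t => _.
have quot : (fun k : R => k^-1 *: ((G \o shift s) (k *: 1) - G s)) =
    (fun h : R => h^-1 *: ((F \o shift (x + s *: u)) (h *: u) - F (x + s *: u))).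
  apply/funext => h; congr (_ *: (F _ - _)).
  by rewrite scalerDl addrCA /GRing.scale /= mulr1.
apply: DeriveDef.
  by have := @diff_derivable _ _ _ _ _ u dF; rewrite /derivable quot.
by rewrite -(deriveE u dF) /derive quot.
Qed.

(** The mean value theorem along the segment from [x] to [x + u] reduces the estimate to the
    first-order expansion of the gradient at [x]. *)
Lemma taylor2 f x : twice_continuously_differentiable f ->
  forall e : R, 0 < e -> \forall u \near (0 : X),
  `|f (x + u) - f x - 'd f x u - 2^-1 * '[hessian f x u, u]| <= e * `|u| ^+ 2.
Proof.
move=> f2 e e0; have df z : differentiable f z by have [] := f2.
have dg := differentiable_gradient x f2.
have : \forall u \near (0 : X),
    `|gradient f (x + u) - gradient f x - hessian f x u| <= e * `|u|.
  have dgx := diff_locallyxC dg.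
  near=> u; rewrite dgx /hessian.
  set k := 'o _.
  rewrite (_ : _ + k u - _ - _ = k u); last first.
    by rewrite -[in LHS]addrA -opprD addrAC subrr add0r.
  by near: u; exact: (littleoP [littleo of k]).
move=> /nbhs_ballP[r /= r0 rP]; apply/nbhs_ballP; exists r => //= u ur.
(* [h] is [f] on the segment minus its linear and quadratic Taylor terms, so that [h 1 - h 0] is the
   remainder to be bounded. *)
pose h : R -> R := (fun s : R => f (x + s *: u)) - 'd f x u *: id
                   - (2^-1 * '[hessian f x u, u]) *: id ^+ 2.
pose dh (s : R) := 'd f (x + s *: u) u - 'd f x u - s * '[hessian f x u, u].
have hd (s : R) : is_derive s 1 h (dh s).
  have := is_derive_line (df (x + s *: u)) => fd.
  apply: is_derive_eq; rewrite /dh /GRing.scale /=.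
  by field.
have hc : {within `[0, 1], continuous h}.
  by apply: derivable_within_continuous => s _; exact: ex_derive.
have [c] := @MVT _ h dh 0 1 ltr01 (fun s _ => hd s) hc.
rewrite in_itv /= => /andP[c0 c1].
rewrite subr0 mulr1 => hdc.
have -> : f (x + u) - f x - 'd f x u - 2^-1 * '[hessian f x u, u] = dh c.
  rewrite -hdc /h !fctE scale0r scale1r addr0 /GRing.scale /=.
  by ring.
have -> : dh c = '[gradient f (x + c *: u) - gradient f x - hessian f x (c *: u), u].
  by rewrite !innerBl !gradientE /hessian linearZ innerZl.
rewrite (le_trans (normr_inner_le _ _))// expr2 mulrA ler_wpM2r//.
have cu : `|c *: u| <= `|u|.
  by rewrite normrZ ger0_norm ?(ltW c0)// ler_piMl// ltW.
rewrite (le_trans (rP _ _))//; last by rewrite ler_wpM2l// ltW.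
by move: ur; rewrite -ball_normE /ball_ /= !sub0r !normrN; exact: le_lt_trans.
Unshelve. all: by end_near. Qed.

End gradient.

Lemma differential_bounded {R : realType} {V W : normedModType R} (f : V -> W) x :
  differentiable f x -> exists2 C : R, 0 < C & forall u, `|'d f x u| <= C * `|u|.
Proof.
move=> df; apply/pinfty_ex_gt0/linear_boundedP/linear_bounded_continuous.
exact: diff_continuous.
Qed.

(** * Smoothness of sums and of inner products with a fixed vector *)

Section smoothness.
Context {R : realType}.

Lemma continuously_differentiableD {V W : normedModType R} (f h : V -> W) :
  continuously_differentiable f -> continuously_differentiable h ->
  continuously_differentiable (f + h).
Proof.
move=> [df cf] [dh ch]; split=> [x|u]; first exact: differentiableD.
have -> : (fun x => 'd (f + h) x u) = (fun x => 'd f x u + 'd h x u).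
  by apply/funext => x; rewrite diffD.
by move=> x; apply: cvgD; [exact: cf|exact: ch].
Qed.

Lemma twice_continuously_differentiableD {V W : normedModType R} (f h : V -> W) :
  twice_continuously_differentiable f -> twice_continuously_differentiable h ->
  twice_continuously_differentiable (f + h).
Proof.
move=> [df cf] [dh ch]; split=> [x|u]; first exact: differentiableD.
have -> : (fun x => 'd (f + h) x u) = (fun x => 'd f x u) + (fun x => 'd h x u).
  by apply/funext => x; rewrite diffD.
exact: continuously_differentiableD.
Qed.

Context {X : normedModType R} {Y : finHilbertType R}.
Implicit Types (F : X -> Y) (x u : X) (y : Y).

Lemma is_diff_inner F x y : differentiable F x ->
  is_diff x (fun z => '[y, F z]) (fun u => '[y, 'd F x u]).
Proof.
move=> dF; pose l : {linear Y -> R^o} := inner y.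
have cl : continuous l by exact: inner_continuous.
have dl := linear_differentiable (F x) cl.
apply: (@DiffDef _ _ _ _ _ (fun z => '[y, F z])).
  exact: (differentiable_comp dF dl).
by rewrite (diff_comp dF dl) (diff_lin _ cl).
Qed.

Lemma differentiable_inner F x y : differentiable F x ->
  differentiable (fun z => '[y, F z]) x.
Proof. by move=> /(is_diff_inner y)[]. Qed.

Lemma diff_inner F x y u : differentiable F x ->
  'd (fun z => '[y, F z]) x u = '[y, 'd F x u].
Proof. by move=> /(is_diff_inner y)[_ ->]. Qed.

Lemma twice_continuously_differentiable_inner F y :
  twice_continuously_differentiable F ->
  twice_continuously_differentiable (fun x => '[y, F x]).
Proof.
move=> [dF d2F]; split=> [x|u]; first exact: differentiable_inner.
have -> : (fun x => 'd (fun z => '[y, F z]) x u) = (fun x => '[y, 'd F x u]).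
  by apply/funext => x; rewrite diff_inner.
have [dFu cFu] := d2F u; split=> [x|v]; first exact: differentiable_inner.
have -> : (fun x => 'd (fun z => '[y, 'd F z u]) x v) =
    (fun x => '[y, 'd (fun z => 'd F z u) x v]).
  by apply/funext => x; rewrite diff_inner.
move=> x; exact: (continuous_comp (cFu v x) (@inner_continuous R Y y _)).
Qed.

End smoothness.

(** * Quadratic remainder bound for vector-valued maps *)

Section vector_remainder.
Context {R : realType} {X Y : finHilbertType R}.

(** Scalar Taylor expansion of each frame coefficient of [F], with the Hessian term absorbed in the
    constant; the frame then reassembles the vector. *)
Lemma first_order_remainder (F : X -> Y) x :
  twice_continuously_differentiable F -> exists2 C : R, 0 < C &
  \forall u \near (0 : X), `|F (x + u) - F x - 'd F x u| <= C * `|u| ^+ 2.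
Proof.
move=> F2; have dF : differentiable F x by have [] := F2.
have coord (b : Y) : exists2 C : R, 0 < C & \forall u \near (0 : X),
    `|'[F (x + u) - F x - 'd F x u, b]| <= C * `|u| ^+ 2.
  have f2 := twice_continuously_differentiable_inner b F2.
  have [M M0 hM] := differential_bounded (differentiable_gradient x f2).
  (* The 1 is the Taylor error for [e = 1]; [M] dominates half the Hessian form. *)
  exists (1 + M) => //; first exact: addr_gt0.
  have := taylor2 x f2 ltr01; apply: filterS => u /=; rewrite diff_inner// mul1r.
  rewrite -!innerBr (innerC _ b). set r := '[b, _] => ru.
  rewrite mulrDl mul1r -(subrK (2^-1 * '[hessian (fun z => '[b, F z]) x u, u]) r).
  rewrite (le_trans (ler_normD _ _))// lerD// normrM ger0_norm//.
  rewrite (le_trans (ler_piMl _ _))// ?invf_le1 ?ler1n//.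
  rewrite (le_trans (normr_inner_le _ _))// expr2 mulrA ler_wpM2r//.
  exact: hM.
have [n [b [d bd]]] := @dual_frame R Y.
have [C C0 hC] : exists2 C : 'I_n -> R, forall i, 0 < C i & forall i,
    \forall u \near (0 : X),
    `|'[F (x + u) - F x - 'd F x u, b i]| <= C i * `|u| ^+ 2.
  have /choice[C hC] : forall i, exists C : R, 0 < C /\ \forall u \near (0 : X),
      `|'[F (x + u) - F x - 'd F x u, b i]| <= C * `|u| ^+ 2.
    by move=> i; have [C] := coord (b i); exists C.
  by exists C => i; have [] := hC i.
(* The added 1 keeps the constant positive even if the sum vanishes, as when [Y] is trivial. *)
exists (1 + \sum_i C i * `|d i|).
  by rewrite ltr_wpDr// sumr_ge0// => i _; rewrite mulr_ge0// ltW.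
have : \forall u \near (0 : X), forall i, 
    `|'[F (x + u) - F x - 'd F x u, b i]| <= C i * `|u| ^+ 2.
  exact: filter_forall.
apply: filterS => u hu.
rewrite [X in `|X|]bd (le_trans (ler_norm_sum _ _ _))// mulrDl mul1r.
rewrite mulr_suml ler_wpDl ?sqr_ge0//; apply: ler_sum => i _.
by rewrite normrZ mulrAC ler_wpM2r.
Qed.

End vector_remainder.

(** * Lower limits and convergence along filters *)

Section lower_limits.
Context {R : realType} {U : choiceType} {T : filteredType U}.
Implicit Types (f : T -> \bar R) (F : set_system T).

Lemma limf_einf_ge f F (a : \bar R) :
  (\forall p \near F, (a <= f p)%E) -> (a <= limf_einf f F)%E.
Proof.
move=> aF; rewrite limf_einfE; apply: le_ereal_sup_tmp.
by exists (ereal_inf (f @` [set p | a <= f p]%E)); [exists [set p | a <= f p]%E|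
  apply: le_ereal_inf_tmp => _ [p ap <-]].
Qed.

(** Every set of [F] is visited by [s] along [G], so its infimum is at most some [c k] close to [a].
    This bounds all the subderivatives from above by a single sequence. *)
Lemma limf_einf_le_along {I : Type} f F (G : set_system I) (s : I -> T)
    (c : I -> R) (a : R) : ProperFilter G -> s @ G `=>` F ->
  (\forall k \near G, (f (s k) <= (c k)%:E)%E) -> c @ G --> a ->
  (limf_einf f F <= a%:E)%E.
Proof.
move=> GG sF fc ca; rewrite limf_einfE; apply: ge_ereal_sup => _ [V FV <-].
apply/lee_addgt0Pr => e e0; rewrite -EFinD.
have /cvgrPdist_le/(_ _ e0) cae := ca.
have GV : G (s @^-1` V) := sF _ FV.
have [k [[Vk fk] ck]] := @filter_ex _ G _ _ (filterI (filterI GV fc) cae).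
apply: (le_trans (ereal_inf_lbound _)); first by exists (s k).
rewrite (le_trans fk)// lee_fin -lerBlDl.
by rewrite (le_trans (ler_norm _))// distrC.
Qed.

End lower_limits.

(** Polarization reduces joint continuity to that of the norm. *)
Lemma cvg_inner {R : realType} {Y : finHilbertType R} {I : Type}
    (G : set_system I) (u v : I -> Y) (a b : Y) : Filter G ->
  u @ G --> a -> v @ G --> b -> '[u k, v k] @[k --> G] --> '[a, b].
Proof.
move=> GG ua vb.
have polar (x y : Y) : '[x, y] = 2^-1 * (`|x + y| ^+ 2 - `|x| ^+ 2 - `|y| ^+ 2).
  by rewrite normr_innerD; field.
rewrite polar; under eq_fun do rewrite polar.
have sq (w : I -> Y) c : w @ G --> c -> `|w k| ^+ 2 @[k --> G] --> `|c| ^+ 2.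
  by move=> wc; apply: cvgM; apply: cvg_norm.
by apply: cvgMl_tmp; apply: cvgB; [apply: cvgB|]; apply: sq => //; exact: cvgD.
Qed.

Lemma cvg_within_in {I T : Type} (G : set_system I) (F : set_system T)
    (A : set T) (s : I -> T) : Filter G ->
  s @ G `=>` F -> (forall k, A (s k)) -> s @ G `=>` within A F.
Proof.
move=> GG sF As P /sF; rewrite /= !nbhs_filterE.
by apply: filterS => k; apply; exact: As.
Qed.

(** A cluster point is a limit: if the preimage of a neighbourhood is not in the ultrafilter, its
    complement is, against clustering. This stands in for extracting subsequences. *)
Lemma compact_ultra_cvg {T : topologicalType} {I : Type} (A : set T)
    (G : set_system I) (s : I -> T) : compact A -> UltraFilter G ->
  (forall k, A (s k)) -> exists2 p, A p & s @ G --> p.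
Proof.
move=> cA UG As.
have GA : G (s @^-1` A) by apply: filterS filterT => k _; exact: As.
have [p [Ap clp]] := cA (s @ G) _ GA.
exists p => // V Vp.
have [//|GV] := in_ultra_setVsetC (s @^-1` V) UG.
by have [q [/= qV]] := clp (~` V) V GV Vp.
Qed.

Lemma cvg_filter_prod {I T1 T2 : Type} (G : set_system I)
    (F1 : set_system T1) (F2 : set_system T2) (u : I -> T1) (v : I -> T2) :
  Filter G -> u @ G `=>` F1 -> v @ G `=>` F2 ->
  (fun k => (u k, v k)) @ G `=>` filter_prod F1 F2.
Proof.
move=> GG uF vF P [[A B] /= [FA FB] AB].
have GA : G (u @^-1` A) := uF _ FA.
have GB : G (v @^-1` B) := vF _ FB.
by apply: filterS2 GA GB => k Ak Bk; exact: AB.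
Qed.

(** * Estimates for the Lagrangian and the augmented Lagrangian *)

Section augmented_lagrangian.
Context {R : realType} {X Y : finHilbertType R}.
Variables (phi : X -> R) (Phi : X -> Y) (g : Y -> \bar R) (Theta : set X).
Implicit Types (x h : X) (y z : Y).

Lemma twice_continuously_differentiable_lagrangian y :
  twice_continuously_differentiable phi ->
  twice_continuously_differentiable Phi ->
  twice_continuously_differentiable (lagrangian phi Phi ^~ y).
Proof.
move=> phi2 Phi2; apply: (twice_continuously_differentiableD phi2).
exact: twice_continuously_differentiable_inner.
Qed.

Lemma gradient_lagrangianE x y h : differentiable phi x ->
  differentiable Phi x ->
  '[gradient (lagrangian phi Phi ^~ y) x, h] = 'd phi x h + '[y, 'd Phi x h].
Proof.
move=> dphi dPhi; rewrite gradientE -(diff_inner y h dPhi).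
by rewrite (diffD dphi (differentiable_inner y dPhi)).
Qed.

Lemma multiplier_ge0 x y x' : multipliers phi Phi g Theta x y -> Theta x' ->
  0 <= '[gradient (lagrangian phi Phi ^~ y) x, x' - x].
Proof.
move=> [[v [_ /(_ x') Nv] /eqP]]; rewrite addr_eq0 => /eqP-> _ /Nv.
by rewrite innerNl oppr_ge0.
Qed.

(** The last term of the expanded square is exactly what the augmented Lagrangian subtracts; the
    double inverse comes from the envelope parameter [rho^-1]. *)
Lemma moreau_expand (rho : R) y z z' : 0 < rho ->
  2^-1 * rho^-1^-1 * `|z + rho^-1 *: y - z'| ^+ 2 =
  '[y, z - z'] + rho / 2 * `|z - z'| ^+ 2 + 2^-1 * rho^-1 * `|y| ^+ 2.
Proof.
move=> rho0; rewrite (addrAC z) (normr_innerD (z - z')) innerZr normrZ exprMn innerC.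
rewrite ger0_norm ?invr_ge0 ?ltW//.
by field; rewrite gt_eqF.
Qed.

(** The competitor [Phi x] in the envelope leaves no term in [y]. *)
Lemma augmented_lagrangian_le x y (rho : R) : 0 < rho ->
  g (Phi x) \is a fin_num ->
  (augmented_lagrangian phi Phi g x y rho <= (phi x + fine (g (Phi x)))%:E)%E.
Proof.
move=> rho0 gx; rewrite /augmented_lagrangian leeBlDr// EFinD -addeA leeD2l//.
apply: ereal_inf_lbound; exists (Phi x) => //.
by rewrite moreau_expand// subrr inner0r normr0 expr0n mulr0 !add0r fineK.
Qed.

(** A strict bound on an infimum is met by some point [z], whether or not the infimum is attained;
    properness makes [g z] finite. *)
Lemma augmented_lagrangian_lt x y (rho c : R) : 0 < rho -> proper_fun g ->
  (augmented_lagrangian phi Phi g x y rho < c%:E)%E ->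
  exists2 z, g z \is a fin_num &
  phi x + fine (g z) + '[y, Phi x - z] + rho / 2 * `|Phi x - z| ^+ 2 < c.
Proof.
move=> rho0 [gNy _]; rewrite /augmented_lagrangian lteBlDr// addeC -lteBrDr//.
rewrite -EFinD => /ereal_inf_lt[_ [z _ <-]].
rewrite moreau_expand// -lteBrDr// -?EFinB => gz.
have gzfin : g z \is a fin_num by rewrite fin_numElt gNy (lt_trans gz)// ltry.
exists z => //; move: gz; rewrite -(fineK gzfin) lte_fin/=.
lra.
Qed.

End augmented_lagrangian.

(** The expansion is made at [ybar]; passing to [y] costs only the pairing of [y - ybar] with the
    first-order remainder of [Phi], which is quadratic in [x - xbar]. Hence a radius uniform in
    [y]. *)
Lemma lagrangian_lower_bound {R : realType} {X Y : finHilbertType R}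
    (phi : X -> R) (Phi : X -> Y) (xbar : X) (ybar : Y) (e : R) :
  twice_continuously_differentiable phi ->
  twice_continuously_differentiable Phi -> 0 < e ->
  exists2 r : R, 0 < r & forall x y, `|x - xbar| < r -> `|y - ybar| < r ->
  '[gradient (lagrangian phi Phi ^~ y) xbar, x - xbar]
  + 2^-1 * '[hessian (lagrangian phi Phi ^~ ybar) xbar (x - xbar), x - xbar]
  - e * `|x - xbar| ^+ 2 <= phi x - phi xbar + '[y, Phi x - Phi xbar].
Proof.
move=> phi2 Phi2 e0.
have dphi : differentiable phi xbar by have [] := phi2.
have dPhi : differentiable Phi xbar by have [] := Phi2.
have L2 := twice_continuously_differentiable_lagrangian ybar phi2 Phi2.
have e20 : 0 < e / 2 by rewrite divr_gt0.
have /nbhs_norm0P[r1 /= r10 taylor] := taylor2 xbar L2 e20.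
have [C C0 /nbhs_norm0P[r2 /= r20 rem]] := first_order_remainder xbar Phi2.
have C20 : 0 < e / 2 / C by rewrite divr_gt0.
(* Half of [e] pays for the Taylor error, the other half for |y - ybar| times [C]. *)
exists (Num.min (Num.min r1 r2) (e / 2 / C)) => [|x y].
  by rewrite !lt_min r10 r20.
rewrite !lt_min => /andP[/andP[x1 x2] _] /andP[_ yC].
have xE : xbar + (x - xbar) = x by rewrite addrC subrK.
have {taylor x1} := taylor _ x1; have {rem x2} := rem _ x2; rewrite !xE.
set u := x - xbar; set h := '[hessian _ _ _, _]; set q := Phi x - _ - _ => qC.
have gE z := gradient_lagrangianE z u dphi dPhi.
have -> : 'd (lagrangian phi Phi ^~ ybar) xbar u =
    'd phi xbar u + '[ybar, 'd Phi xbar u] by rewrite -gE gradientE.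
rewrite (gE y) /lagrangian.
have : - (e / 2 * `|u| ^+ 2) <= '[y - ybar, q].
  rewrite lerNl (le_trans (ler_norm _))// normrN.
  rewrite (le_trans (normr_inner_le _ _))//.
  rewrite (le_trans (ler_wpM2l (normr_ge0 _) qC))// mulrA ler_wpM2r ?sqr_ge0//.
  by rewrite -ler_pdivlMr// ltW.
rewrite /q !innerBl !innerBr ler_norml => + /andP[+ _].
rewrite {qC}/q {xE}; clear; move: h => h.
move: ('[y, Phi x]) ('[y, Phi xbar]) ('[y, 'd Phi xbar u]) => a1 a2 a3.
move: ('[ybar, Phi x]) ('[ybar, Phi xbar]) ('[ybar, 'd Phi xbar u]) => b1 b2 b3.
move: (`|u| ^+ 2) ('d phi xbar u) => c d.
lra.
Qed.

Lemma squeeze_norm0 {R : realType} {W : normedModType R} {I : Type}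
    (G : set_system I) (f : I -> W) (c : I -> R) : Filter G ->
  (\forall k \near G, `|f k| <= c k) -> c @ G --> 0 -> f @ G --> 0.
Proof.
move=> GG fc c0; apply/norm_cvg0P.
apply: (squeeze_cvgr _ (cvg_cst 0) c0).
by apply: filterS fc => k ->; rewrite normr_ge0.
Qed.

(** * The critical limit direction of a violating sequence *)

Section limit_direction.
Context {R : realType} {X Y : finHilbertType R}.
Context (phi : X -> R) (Phi : X -> Y) (g : Y -> \bar R) (Theta : set X).
Context (xbar : X) (ybar : Y).

(** At a feasible point the quotients of an indicator are nonnegative, which supplies the reverse
    inequality. *)
Lemma critical_indicator (v w : X) : Theta xbar -> '[v, w] = 0 ->
  (subderivative (indicator Theta) xbar w <= 0)%E ->
  critical_cone (indicator Theta) xbar v w.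
Proof.
move=> Txbar vw0 le0; rewrite /critical_cone /= vw0; apply/eqP.
rewrite eq_le le0 andbT; apply: limf_einf_ge; near=> p.
rewrite {2}/indicator mem_set// sube0; apply: mule_ge0.
  by rewrite /indicator; case: ifP.
rewrite lee_fin invr_ge0 ltW//; near: p.
exact: (cvg_fst (nbhs_right_gt 0)).
Unshelve. all: by end_near. Qed.

(** The subgradient inequality bounds the difference quotients below by <y, w'>, and w' tends to
    [w]; this is the reverse inequality. *)
Lemma critical_subgradient (y w : Y) : subdifferential g (Phi xbar) y ->
  (subderivative g (Phi xbar) w <= '[y, w]%:E)%E ->
  critical_cone g (Phi xbar) y w.
Proof.
move=> [gfin sub] le; apply/eqP; rewrite eq_le le andbT.
apply/lee_subgt0Pr => e e0; rewrite -EFinB.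
apply: limf_einf_ge; near=> p.
have p0 : 0 < p.1 by near: p; exact: (cvg_fst (nbhs_right_gt 0)).
have := sub (Phi xbar + p.1 *: p.2).
rewrite [_ - Phi xbar]addrC addKr innerZr => gp.
apply: (@le_trans _ _ '[y, p.2]%:E).
  rewrite lee_fin lerBlDl -lerBlDr (le_trans (ler_norm _))//; near: p.
  have /cvgrPdist_le/(_ _ e0) := @inner_continuous _ _ y w.
  exact: cvg_snd.
by rewrite lee_pdivlMr// leeBrDr// addeC -EFinM mulrC.
Unshelve. all: by end_near. Qed.

(** The slack [2 * e] is the error [e] of the Lagrangian expansion after division by t^2 / 2. *)
Lemma limit_direction (e kappa : R) (G : set_system nat)
    (x : nat -> X) (y z : nat -> Y) (rho : nat -> R) :
  twice_continuously_differentiable phi ->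
  twice_continuously_differentiable Phi ->
  kkt_solution phi Phi g Theta xbar ybar ->
  UltraFilter G -> 0 < e ->
  x @ G --> xbar -> y @ G --> ybar -> (fun k => (rho k)^-1) @ G --> (0 : R) ->
  (forall k, 0 < rho k) -> (forall k, Theta (x k)) ->
  (forall k, multipliers phi Phi g Theta xbar (y k)) ->
  (forall k, g (z k) \is a fin_num) ->
  (forall k, phi (x k) - phi xbar + '[y k, Phi (x k) - Phi xbar]
    + (fine (g (z k)) - fine (g (Phi xbar)) - '[y k, z k - Phi xbar])
    + rho k / 2 * `|Phi (x k) - z k| ^+ 2 < kappa / 2 * `|x k - xbar| ^+ 2) ->
  exists w, [/\ `|w| = 1, critical_directions phi Phi g Theta xbar ybar w &
    (semistrict_second_subderivative g (Phi xbar) ybar ('d Phi xbar w) <=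
     (kappa + 2 * e
      - '[hessian (lagrangian phi Phi ^~ ybar) xbar w, w])%:E)%E].
Proof.
move=> phi2 Phi2 kkt UG e0 xG yG rhoG rho0 Tx My gz lt.
have dphi : differentiable phi xbar by have [] := phi2.
have dPhi : differentiable Phi xbar by have [] := Phi2.
have subg k : subdifferential g (Phi xbar) (y k) by have [] := My k.
have [gbar _] := subg 0.
have Txbar : Theta xbar by have [[v []]] := kkt.
set H := hessian _ _ in lt *.
pose t k := `|x k - xbar|; pose s k := `|Phi (x k) - z k|.
pose D k := fine (g (z k)) - fine (g (Phi xbar)) - '[y k, z k - Phi xbar].
have D0 k : 0 <= D k.
  have [_ /(_ (z k))] := subg k.
  rewrite -(fineK gbar) -(fineK (gz k)) lee_fin /D.
  by move: ('[_, _]) => q; rewrite /=; lra.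
have rs0 k : 0 <= rho k / 2 * s k ^+ 2.
  by rewrite mulr_ge0 ?sqr_ge0// divr_ge0// ltW.
(* If [x k = xbar], the violated inequality would make a sum of nonnegative terms negative. *)
have t0 k : 0 < t k.
  rewrite lt_neqAle normr_ge0 andbT eq_sym normr_eq0 subr_eq0; apply/eqP => xE.
  have := lt k; rewrite -/(D k) -/(s k) xE !subrr inner0r normr0 expr0n mulr0 !add0r.
  by rewrite ltNge addr_ge0.
pose w k := (t k)^-1 *: (x k - xbar).
have w1 k : `|w k| = 1.
  by rewrite normrZ ger0_norm ?invr_ge0 ?ltW// mulVf// gt_eqF.
have tw k : t k *: w k = x k - xbar by rewrite scalerA divff ?scale1r// gt_eqF.
have [wb wb1 wG] := compact_ultra_cvg sphere_compact UG w1.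
have tG : t @ G --> (0 : R).
  rewrite -[0](@normr0 _ X) -(subrr xbar); apply: cvg_norm.
  by apply: cvgB => //; exact: cvg_cst.
pose a k := '[gradient (lagrangian phi Phi ^~ (y k)) xbar, w k].
have a0 k : 0 <= a k.
  rewrite -(pmulr_rge0 _ (t0 k)) -innerZr tw.
  exact: (multiplier_ge0 (My k)).
have dG : differentiable (gradient (lagrangian phi Phi ^~ ybar)) xbar.
  exact/differentiable_gradient/twice_continuously_differentiable_lagrangian.
have [M M0 HM] := differential_bounded dG.
pose hw k := '[H (w k), w k].
have hwM k : `|hw k| <= M.
  rewrite (le_trans (normr_inner_le _ _))// w1 mulr1.
  by rewrite (le_trans (HM _))// w1 mulr1.
have hwG : hw @ G --> '[H wb, wb].
  apply: cvg_inner => //.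
  have Hc : continuous H by exact: (diff_continuous dG).
  exact: (cvg_comp _ _ wG (Hc wb)).
have [r r0 lower] := lagrangian_lower_bound xbar ybar phi2 Phi2 e0.
(* [K] replaces the Hessian term [hw k] by its bound [M] on unit vectors. *)
pose K := kappa / 2 + e + M / 2.
have HxE k : '[H (x k - xbar), x k - xbar] = t k * (t k * hw k).
  have HZ c v : H (c *: v) = c *: H v by rewrite /H /hessian linearZ.
  by rewrite -tw innerZr HZ innerZl.
have aE k : '[gradient (lagrangian phi Phi ^~ (y k)) xbar, x k - xbar] = t k * a k.
  by rewrite -tw innerZr.
(* The three summands on the left are nonnegative, so each one is separately bounded by the
   right-hand side. *)
have main : \forall k \near G,
    t k * a k + D k + rho k / 2 * s k ^+ 2 <=
    (kappa / 2 + e - hw k / 2) * t k ^+ 2.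
  near=> k.
  have := lt k; rewrite -/(D k) -/(s k) -/(t k).
  have := lower (x k) (y k); rewrite aE -/H HxE -/(t k) => lowk.
  have {lowk} : t k * a k + 2^-1 * (t k * (t k * hw k)) - e * t k ^+ 2 <=
      phi (x k) - phi xbar + '[y k, Phi (x k) - Phi xbar].
    by apply: lowk; near: k; exact: cvgr_distC_lt.
  move: ('[_, _]) => q; move: (rho k / 2 * s k ^+ 2) => rs.
  rewrite expr2; lra.
have tt0 k : 0 < t k ^+ 2 by rewrite exprn_gt0.
have bound : \forall k \near G,
    t k * a k + D k + rho k / 2 * s k ^+ 2 <= K * t k ^+ 2.
  apply: filterS main => k /le_trans; apply; rewrite ler_pM2r// /K.
  by have := hwM k; rewrite ler_norml => /andP[+ _]; lra.
have cPhi : continuous ('d Phi xbar) by exact: (diff_continuous dPhi).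
have cphi : continuous ('d phi xbar) by exact: (diff_continuous dphi).
have PwG : (fun k => 'd Phi xbar (w k)) @ G --> 'd Phi xbar wb.
  exact: (cvg_comp _ _ wG (cPhi wb)).
(* Stationarity gives [0 <= a k], and [bound] divided by [t k ^+ 2], up to one factor [t k], gives
   [a k <= K * t k]; both sides pass to the limit. *)
have grad0 : '[gradient (lagrangian phi Phi ^~ ybar) xbar, wb] = 0.
  have aG : a @ G --> '[gradient (lagrangian phi Phi ^~ ybar) xbar, wb].
    rewrite gradient_lagrangianE//.
    have -> : a = (fun k => 'd phi xbar (w k) + '[y k, 'd Phi xbar (w k)]).
      by apply/funext => k; rewrite -gradient_lagrangianE.
    apply: cvgD; last exact: cvg_inner.
    exact: (cvg_comp _ _ wG (cphi wb)).
  apply/eqP; rewrite eq_le; apply/andP; split; last first.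
    by apply: (ler_cvg_to (cvg_cst 0) aG); apply: filterE.
  have KtG : (fun k => K * t k) @ G --> (0 : R).
    by rewrite -[0](mulr0 K); exact: cvgMl_tmp.
  apply: (ler_cvg_to aG KtG); apply: filterS bound => k bk.
  rewrite -(ler_pM2l (t0 k)) mulrCA -expr2; apply: le_trans bk.
  by rewrite -addrA lerDl addr_ge0.
(* The penalty term gives (s / t)^2 <= 2 K / rho, and the penalty parameter tends to infinity. *)
have st2G : (fun k => (s k / t k) ^+ 2) @ G --> (0 : R).
  apply: (@squeeze_norm0 _ _ _ _ _ (fun k => 2 * K * (rho k)^-1)); last first.
    by rewrite -[0](mulr0 (2 * K)); exact: cvgMl_tmp.
  apply: filterS bound => k bk.
  rewrite ger0_norm ?sqr_ge0// expr_div_n ler_pdivrMr// mulrAC ler_pdivlMr//.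
  have : rho k / 2 * s k ^+ 2 <= K * t k ^+ 2.
    by apply: le_trans bk; rewrite lerDr addr_ge0// mulr_ge0// ltW.
  by move: (s k ^+ 2) (t k ^+ 2) => ss tt; lra.
have stG : (fun k => s k / t k) @ G --> (0 : R).
  have -> : (fun k => s k / t k) = Num.sqrt \o (fun k => (s k / t k) ^+ 2).
    by apply/funext => k /=; rewrite sqrtr_sqr ger0_norm// divr_ge0// normr_ge0.
  by have := cvg_comp _ _ st2G (@sqrt_continuous R 0); rewrite sqrtr0.
pose w' k := (t k)^-1 *: (z k - Phi xbar).
have zE k : Phi xbar + t k *: w' k = z k.
  by rewrite scalerA divff ?gt_eqF// scale1r addrC subrK.
have yE k : t k * '[y k, w' k] = '[y k, z k - Phi xbar].
  by rewrite -innerZr scalerA divff ?gt_eqF// scale1r.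
have Dle k c : t k * a k + D k + rho k / 2 * s k ^+ 2 <= c -> D k <= c.
  by apply: le_trans; rewrite addrAC lerDr addr_ge0// mulr_ge0// ltW.
(* [w' k - 'd Phi xbar (w k)] is the remainder of [Phi] over [t k], at most [C * t k], minus a
   vector of norm [s k / t k]. *)
have w'G : w' @ G --> 'd Phi xbar wb.
  have [C C0 rem] := first_order_remainder xbar Phi2.
  pose dw k := w' k - 'd Phi xbar (w k).
  have dwG : dw @ G --> (0 : Y).
    apply: (@squeeze_norm0 _ _ _ _ _ (fun k => C * t k + s k / t k)); last first.
      rewrite -[0](addr0 0) -{1}(mulr0 C).
      by apply: cvgD => //; exact: cvgMl_tmp.
    have uG : (fun k => x k - xbar) @ G --> (0 : X).
      by rewrite -(subrr xbar); apply: cvgB => //; exact: cvg_cst.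
    have remG : \forall k \near G,
        `|Phi (xbar + (x k - xbar)) - Phi xbar - 'd Phi xbar (x k - xbar)|
        <= C * `|x k - xbar| ^+ 2 by exact: uG _ rem.
    apply: filterS remG => k; rewrite [xbar + _]addrC subrK => remk.
    have -> : dw k = (t k)^-1 *: (Phi (x k) - Phi xbar - 'd Phi xbar (x k - xbar))
        - (t k)^-1 *: (Phi (x k) - z k).
      rewrite /dw /w' /w linearZ /= -!scalerBr; congr (_ *: _).
      by rewrite [RHS]addrC opprB !addrA subrK.
    rewrite (le_trans (ler_normB _ _))// !normrZ ger0_norm ?invr_ge0 ?(ltW (t0 _))//.
    by rewrite [_^-1 * `|Phi _ - _|]mulrC lerD2r ler_pdivrMl// mulrCA -expr2.
  have -> : w' = dw \+ (fun k => 'd Phi xbar (w k)).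
    by apply/funext => k /=; rewrite subrK.
  by rewrite -['d Phi xbar wb]add0r; exact: cvgD.
have tG0 : t @ G `=>` 0^'+ by exact: cvg_within_in.
exists wb; split=> //.
  split.
    apply: critical_indicator => //; first by rewrite innerNl grad0 oppr0.
    (* The points [xbar + t k *: w k = x k] lie in [Theta], so these quotients vanish. *)
    apply: (@limf_einf_le_along _ _ _ _ _ _ G (fun k => (t k, w k)) (cst 0)).
    - exact: cvg_filter_prod.
    - apply: filterE => k /=; rewrite tw [xbar + _]addrC subrK /indicator.
      by rewrite !mem_set// subee// mul0e.
    - exact: cvg_cst.
  apply: critical_subgradient; first by have [] := kkt.
  (* The quotient of [g] equals [D k / t k + '[y k, w' k]], and [D k <= K * t k ^+ 2]. *)
  apply: (@limf_einf_le_along _ _ _ _ _ _ G (fun k => (t k, w' k))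
            (fun k => K * t k + '[y k, w' k])).
  - exact: cvg_filter_prod.
  - apply: filterS bound => k /= bk; rewrite zE -(fineK gbar) -(fineK (gz k)).
    rewrite -EFinB -EFinM lee_fin ler_pdivrMr// mulrDl -mulrA -expr2.
    rewrite [_ * t k]mulrC yE -lerBlDr.
    exact: Dle bk.
  - rewrite -['[ybar, _]]add0r -{1}(mulr0 K); apply: cvgD; last exact: cvg_inner.
    exact: cvgMl_tmp.
(* The [y k] are subgradients tending to [ybar], as the semi-strict version allows; the second-order
   quotient is [D k] over t^2 / 2, bounded by [main]. *)
apply: (@limf_einf_le_along _ _ _ _ _ _ G (fun k => ((t k, w' k), y k))
            (fun k => kappa + 2 * e - hw k)).
- apply: cvg_filter_prod; first exact: cvg_filter_prod.
  exact: cvg_within_in.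
- apply: filterS main => k /= bk; rewrite /diff_quotient2 /=.
  rewrite zE -(fineK gbar) -(fineK (gz k)).
  rewrite -!EFinB -EFinM lee_fin ler_pdivrMr ?mulr_gt0//.
  rewrite yE -/(D k); have := Dle k _ bk.
  by move: (t k ^+ 2) => tt; lra.
- by apply: cvgB => //; exact: cvg_cst.
Unshelve. all: by end_near. Qed.
End limit_direction.

(** * Uniform quadratic growth by contradiction *)

Theorem theorem4p7 (R : realType) (X Y : finHilbertType R)
    (phi : X -> R) (Phi : X -> Y) (g : Y -> \bar R) (Theta : set X)
    (xbar : X) (ybar : Y) (ell : R)
    (phi_C2 : twice_continuously_differentiable phi)
    (Phi_C2 : twice_continuously_differentiable Phi)
    (g_proper : proper_fun g)
    (g_lsc : lower_semicontinuous g)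
    (g_convex : convex_efun g)
    (Theta_polyhedral : polyhedral Theta)
    (kkt : kkt_solution phi Phi g Theta xbar ybar)
    (g_semi_stable : semi_stable g (Phi xbar) ybar)
    (ell_gt0 : 0 < ell)
    (second_order : forall w,
      critical_directions phi Phi g Theta xbar ybar w ->
      ((ell * `|w| ^+ 2)%:E <=
        '[hessian (lagrangian phi Phi ^~ ybar) xbar w, w]%:E
        + second_subderivative g (Phi xbar) ybar ('d Phi xbar w))%E) :
  forall kappa : R, 0 <= kappa < ell ->
  exists rhobar gamma : R, [/\ 0 < rhobar, 0 < gamma &
    forall (x : X) (y : Y) (rho : R),
      Theta x -> closed_ball xbar gamma x ->
      multipliers phi Phi g Theta xbar y -> closed_ball ybar gamma y ->
      rhobar <= rho ->
      (augmented_lagrangian phi Phi g xbar y rho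
         + (kappa / 2 * `|x - xbar| ^+ 2)%:E
       <= augmented_lagrangian phi Phi g x y rho)%E].
Proof.
move=> kappa /andP[kappa0 kappa_ell]; apply: contrapT => nogrowth.
have [gbar _] : subdifferential g (Phi xbar) ybar by have [] := kkt.
have bad (k : nat) : exists p : X * Y * Y * R, let: (x, y, z, rho) := p in
    [/\ Theta x, `|xbar - x| <= k.+1%:R^-1,
        multipliers phi Phi g Theta xbar y, `|ybar - y| <= k.+1%:R^-1 &
        [/\ k.+1%:R <= rho, g z \is a fin_num &
    phi x - phi xbar + '[y, Phi x - Phi xbar]
    + (fine (g z) - fine (g (Phi xbar)) - '[y, z - Phi xbar])
    + rho / 2 * `|Phi x - z| ^+ 2 < kappa / 2 * `|x - xbar| ^+ 2]].
  apply: contrapT => nobad; apply: nogrowth.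
  have k0 : 0 < k.+1%:R^-1 :> R by rewrite invr_gt0.
  (* Without a violating point at stage [k], these constants would give the growth condition; the
     successor keeps them positive. *)
  exists k.+1%:R, k.+1%:R^-1; split=> // x y rho Tx + My + krho.
  rewrite !closed_ballE// => xk yk; have rho0 : 0 < rho by exact: lt_le_trans krho.
  rewrite leNgt; apply/negP => lt.
  have [|z gz ltz] := @augmented_lagrangian_lt _ _ _ phi Phi g x y rho
    (phi xbar + fine (g (Phi xbar)) + kappa / 2 * `|x - xbar| ^+ 2) rho0 g_proper.
    rewrite (lt_le_trans lt)// EFinD leeD2r//.
    exact: augmented_lagrangian_le.
  apply: nobad; exists (x, y, z, rho); split=> //; split=> //.
  move: ltz; rewrite !innerBr.
  move: ('[y, Phi x]) ('[y, Phi xbar]) ('[y, z]) (rho / 2 * _) (kappa / 2 * _).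
  by move=> *; lra.
have [p badp] := choice bad.
pose x k := (p k).1.1.1; pose y k := (p k).1.1.2.
pose z k := (p k).1.2; pose rho k := (p k).2.
have {badp}badp k := badp k.
have xyz k : p k = (x k, y k, z k, rho k).
  by rewrite /x /y /z /rho; case: (p k) => [[[]]].
have harm : (fun k => k.+1%:R^-1) @ \oo --> (0 : R) by exact: cvg_harmonic.
(* An ultrafilter finer than \oo keeps limits at infinity and makes sequences in compact sets
   converge. *)
have [G [UG Goo]] := @ultraFilterLemma _ \oo _.
have harmG : (fun k => k.+1%:R^-1) @ G --> (0 : R) by move=> A /harm /Goo.
have Tx k : Theta (x k) by have := badp k; rewrite xyz => -[].
have xk k : `|xbar - x k| <= k.+1%:R^-1 by have := badp k; rewrite xyz => -[].
have My k : multipliers phi Phi g Theta xbar (y k).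
  by have := badp k; rewrite xyz => -[].
have yk k : `|ybar - y k| <= k.+1%:R^-1 by have := badp k; rewrite xyz => -[].
have rk k : k.+1%:R <= rho k by have := badp k; rewrite xyz => -[_ _ _ _ []].
have gz k : g (z k) \is a fin_num by have := badp k; rewrite xyz => -[_ _ _ _ []].
have lt k : phi (x k) - phi xbar + '[y k, Phi (x k) - Phi xbar]
    + (fine (g (z k)) - fine (g (Phi xbar)) - '[y k, z k - Phi xbar])
    + rho k / 2 * `|Phi (x k) - z k| ^+ 2 < kappa / 2 * `|x k - xbar| ^+ 2.
  by have := badp k; rewrite xyz => -[_ _ _ _ []].
have rho0 k : 0 < rho k by rewrite (lt_le_trans _ (rk k)).
have cvg_bound (V : normedModType R) (u : nat -> V) (v : V) :
    (forall k, `|v - u k| <= k.+1%:R^-1) -> u @ G --> v.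
  move=> uv; apply/subr_cvg0; apply: squeeze_norm0 harmG.
  by apply: filterE => k; rewrite distrC.
(* With this [e], [kappa + 2 * e] is the midpoint of [kappa] and [ell], still below [ell]. *)
have e0 : 0 < (ell - kappa) / 4 by rewrite divr_gt0// subr_gt0.
have [|w [w1 wcrit sle]] :=
  @limit_direction _ _ _ phi Phi g Theta xbar ybar _ kappa G x y z rho
  phi_C2 Phi_C2 kkt UG e0
  (cvg_bound _ _ _ xk) (cvg_bound _ _ _ yk) _ rho0 Tx My gz lt.
  apply: squeeze_norm0 harmG; apply: filterE => k.
  by rewrite ger0_norm ?invr_ge0 ?(ltW (rho0 k))// lef_pV2// posrE.
(* Semi-stability at the critical direction ['d Phi xbar w] lets [sle] bound the second
   subderivative; the Hessian terms cancel, leaving [ell <= kappa + 2 * e]. *)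
have := second_order w wcrit; have [_ /g_semi_stable <-] := wcrit.
rewrite w1 expr1n mulr1; set h := '[_, _] => /le_trans /(_ (leeD2l _ sle)).
by rewrite -EFinD lee_fin; lra.
Qed.
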